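(* Suppose that $0<s<1$ and $1\le p<\infty$ satisfy $sp<1$. Then there is a constant $C>0$ independent of the mesh size $h$ such that for every $v_h\in X_h$, $$[v_h]_{W^{1+s,p}(0,1)}\le C\,h^{-s}\,\|v_h\|_{W^{1,p}(0,1)}.$$ In particular, $v_h\in W^{1+s,p}(0,1)$.
   Context: For an integer $N\ge1$ let $h=1/N$, $x_j=jh$ ($0\le j\le N$), $I_k=(x_k,x_{k+1})$, and $X_h:=\{v_h\in C([0,1]): v_h|_{I_k}\text{ is affine for all }0\le k\le N-1,\ v_h(0)=0,\ v_h(1)=1\}$. For $0<s<1$ and $1\le p<\infty$, $[v]^p_{W^{1+s,p}(0,1)}:=\int_0^1\int_0^1\frac{|v'(x)-v'(y)|^p}{|x-y|^{1+sp}}\,dx\,dy$, and $W^{1+s,p}(0,1)$ is the set of $v\in W^{1,p}(0,1)$ with $[v]_{W^{1+s,p}(0,1)}<\infty$. Also $\|v\|^p_{W^{1,p}(0,1)}=\|v\|^p_{L^p(0,1)}+\|v'\|^p_{L^p(0,1)}$. *)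

(* Defs.v *)
From HB Require Import structures.
From mathcomp Require Import all_boot all_order all_algebra.
From mathcomp Require Import all_classical all_reals all_analysis.

Set Implicit Arguments.
Unset Strict Implicit.
Unset Printing Implicit Defensive.

Import Order.TTheory GRing.Theory Num.Theory.
Import numFieldNormedType.Exports.

Local Open Scope classical_set_scope.
Local Open Scope ring_scope.

(* Functions on (0,1) (or [0,1]) are represented by total functions R -> R
   whose values outside the interval are never used. *)

Definition unit_itv (R : realType) : set R := `]0, 1[.
Arguments unit_itv : clear implicits.

Definition test_function (R : realType) (phi : R -> R) : Prop :=
  [/\ forall (n : nat) (x : R), derivable (derive1n n phi) x 1,
      compact (closure [set x | phi x != 0]) &
      closure [set x | phi x != 0] `<=` unit_itv R].

Definition is_weak_derivative (R : realType) (v g : R -> R) : Prop :=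
  [/\ locally_integrable (unit_itv R) v,
      locally_integrable (unit_itv R) g &
      forall phi : R -> R, test_function phi ->
        \int[lebesgue_measure]_(x in unit_itv R) (v x * derive1 phi x) =
        - \int[lebesgue_measure]_(x in unit_itv R) (g x * phi x)].

(* A representative of v'; it is unique up to a null subset of (0,1), and is
   the zero function when v is not weakly differentiable. *)
Definition weak_derivative (R : realType) (v : R -> R) : R -> R :=
  xget (cst 0) [set g | is_weak_derivative v g].

Definition in_Lp (R : realType) (p : R) (v : R -> R) : Prop :=
  v \_ (unit_itv R) \in Lfun (@lebesgue_measure R) p%:E.

Definition Lp_norm (R : realType) (p : R) (v : R -> R) : \bar R :=
  'N[@lebesgue_measure R]_p%:E[EFin \o (v \_ (unit_itv R))]%E.

Definition in_W1p (R : realType) (p : R) (v : R -> R) : Prop :=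
  in_Lp p v /\ exists2 g : R -> R, is_weak_derivative v g & in_Lp p g.

Definition W1p_norm (R : realType) (p : R) (v : R -> R) : \bar R :=
  ((Lp_norm p v `^ p + Lp_norm p (weak_derivative v) `^ p) `^ p^-1)%E.

(* On the diagonal x = y, which is a null set, the integrand evaluates to 0. *)
Definition W1sp_seminorm (R : realType) (s p : R) (v : R -> R) : \bar R :=
  ((\int[lebesgue_measure]_(x in unit_itv R)
      (\int[lebesgue_measure]_(y in unit_itv R)
         (`|weak_derivative v x - weak_derivative v y| `^ p
          / `|x - y| `^ (1 + s * p))%R%:E)) `^ p^-1)%E.

Definition in_W1sp (R : realType) (s p : R) (v : R -> R) : Prop :=
  in_W1p p v /\ (W1sp_seminorm s p v < +oo)%E.

Definition mesh_size (R : realType) (N : nat) : R := N%:R^-1.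

Definition mesh_point (R : realType) (N j : nat) : R := j%:R * mesh_size R N.

Definition X_h (R : realType) (N : nat) (v : R -> R) : Prop :=
  [/\ {within `[0, 1], continuous v},
      forall k : nat, (k < N)%N -> exists a b : R,
        {in `]mesh_point R N k, mesh_point R N k.+1[, forall x, v x = a * x + b},
      v 0 = 0 & v 1 = 1].

(* Main.v *)
Require Import Defs.
From mathcomp Require Import all_boot all_order all_algebra.
From mathcomp Require Import all_classical all_reals all_analysis.
From mathcomp Require Import measurable_realfun ring lra.
Import Order.TTheory GRing.Theory Num.Theory.
Import numFieldNormedType.Exports.
Local Open Scope classical_set_scope.
Local Open Scope ring_scope.

Set Implicit Arguments.
Unset Strict Implicit.
Unset Printing Implicit Defensive.

(** Write [q = s p < 1], let [I_k] be the mesh cells and [a_k] the slopes of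
    [v]. The weak derivative of [v] is a.e. the step function [g] with value
    [a_k] on [I_k], so the difference [g x - g y] vanishes when [x] and [y] lie
    in the same cell, and otherwise
    [|g x - g y|^p <= 2^p (|g x|^p + |g y|^p)]. By the symmetry of the kernel the
    [p]-th power of the seminorm is at most
    [2 * 2^p * sum_k |a_k|^p J_k], where [J_k] is the integral of
    [|x - y|^(-1-q)] over [x] in [I_k] and [y] in [(0,1)] outside [I_k]. The inner
    integral is at most [1/q] times the sum of the [-q]-th powers of the distances
    from [x] to the two ends of [I_k], which is integrable since [q < 1]; this
    gives [J_k <= 2 h^(1-q) / (q (1-q))]
    ([integral_riesz_kernel_cell]). Because [sum_k h |a_k|^p] is the [p]-th power
    of the [L^p] norm of [g], the total is at most
    [C h^(-q) ||g||_p^p] ([gagliardo_step_le]), and [p]-th roots give the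
    factor [h^(-s)].

    The seminorm is defined through an arbitrarily chosen weak derivative, so two
    facts about weak derivatives are required: that [g] is one, by integration
    by parts on each cell ([step_weak_derivative]), and that any two agree a.e.
    ([weak_derivative_ae_unique]). The latter rests on explicit smooth bumps
    converging to indicators of intervals, built from [exp(-1/x)], and on
    Lebesgue's differentiation theorem. *)

Lemma is_derive_affine (R : realType) (s t x : R) :
  is_derive x 1 (fun y => s * y + t) s.
Proof.
have d1 : is_derive x 1 (fun y => s * y) s.
  by apply: (is_derive_eq (is_deriveZ s (is_derive_id x 1))); exact: mulr1.
by apply: (is_derive_eq (is_deriveD d1 (is_derive_cst t x 1))); rewrite addr0.
Qed.

(** * Smooth bump functions *)

Section SmoothBumps.
Context {R : realType}.
Implicit Types (f g : R -> R) (P : {poly R}) (a b c d x y : R).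

(** Differentiating [exp(-1/x)] on the positive axis multiplies it by a
    polynomial in [1/x]; carrying that polynomial as a parameter makes the
    family closed under differentiation. *)
Definition flat P (x : R) : R := if 0 < x then P.[x^-1] * expR (- x^-1) else 0.

Lemma flat_le0 P x : x <= 0 -> flat P x = 0.
Proof. by move=> x0; rewrite /flat ltNge x0. Qed.

Lemma flat_gt0 P x : 0 < x -> flat P x = P.[x^-1] * expR (- x^-1).
Proof. by move=> x0; rewrite /flat x0. Qed.

Lemma horner_le_expR P : exists2 C : R, 0 <= C &
  forall y, 0 <= y -> `|P.[y]| <= C * expR y.
Proof.
exists (\sum_(i < size P) `|P`_i| * i`!%:R).
  by apply: sumr_ge0 => i _; rewrite mulr_ge0.
move=> y y0; rewrite horner_coef mulr_suml.
apply: le_trans (ler_norm_sum _ _ _) _; apply: ler_sum => i _.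
rewrite normrM -mulrA ler_wpM2l// ger0_norm ?exprn_ge0//.
case: (nat_of_ord i) => [|n].
  by rewrite expr0 fact0 mul1r; have := expR_ge1Dx y; lra.
have := expR_ge1Dxn n y0.
rewrite -ler_pdivrMl ?ltr0n ?fact_gt0// mulrC.
lra.
Qed.

(** The exponential beats every power of [1/x], here with two powers to spare:
    the quadratic bound is what makes the difference quotient at [0] vanish. *)
Lemma flat_le_sqr P : exists2 C : R, 0 <= C & forall x, `|flat P x| <= C * x ^+ 2.
Proof.
have [C C0 PC] := horner_le_expR ('X^2 * P).
(* with y = 1/x the claim reads |y^2 P(y)| <= C exp(y) *)
exists C => // x; have [x0|x0] := lerP x 0.
  by rewrite flat_le0// normr0 mulr_ge0// sqr_ge0.
rewrite flat_gt0//.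
have xV0 : 0 <= x^-1 by rewrite invr_ge0 ltW.
have := PC _ xV0; rewrite hornerM hornerXn normrM (ger0_norm (exprn_ge0 _ xV0)) => H.
rewrite normrM (ger0_norm (expR_ge0 _)) expRN ler_pdivrMr ?expR_gt0//.
rewrite mulrAC -ler_pdivrMr ?exprn_gt0// mulrC.
by rewrite -exprVn.
Qed.

Lemma is_derive_flat P x :
  is_derive x 1 (flat P) (flat ('X^2 * (P - P^`()%R)) x).
Proof.
have [x0|x0|->] := ltgtP x 0.
- rewrite flat_le0 ?ltW//.
  apply: (near_eq_is_derive (f := cst 0)).
  near=> t; rewrite flat_le0//; apply: ltW; near: t; exact: lt_nbhsl.
- rewrite flat_gt0//.
  apply: (@near_eq_is_derive _ R R (fun t : R => P.[t^-1] * expR (- t^-1))).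
  + by near=> t; rewrite flat_gt0//; near: t; exact: lt_nbhsr.
  + have xN0 : x != 0 by rewrite gt_eqF.
    have dV : is_derive x 1 (fun t : R => t^-1) (- x ^- 2).
      have := @is_deriveV _ id x 1 1 xN0 _; rewrite /= scaler1; exact.
    have dP : is_derive x 1 (fun t => P.[t^-1]) (P^`()%R.[x^-1] * (- x ^- 2)).
      exact: (@is_derive1_comp _ (horner P) (fun t => t^-1)).
    have dE : is_derive x 1 (fun t => expR (- t^-1)) (expR (- x^-1) * (x ^- 2)).
      have dN : is_derive x 1 (fun t : R => - t^-1) (x ^- 2).
        by rewrite -[_ ^- 2]opprK; exact: is_deriveN.
      exact: (@is_derive1_comp _ expR (fun t => - t^-1)).
    apply: (is_derive_eq (is_deriveM dP dE)).
    rewrite hornerM hornerXn hornerD hornerN /GRing.scale/= exprVn.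
    by ring.
- rewrite flat_le0//.
  have [C C0 PC] := flat_le_sqr P.
  have cv : h^-1 *: (flat P (h *: 1 + 0) - flat P 0) @[h --> 0^'] --> (0 : R).
    apply/cvgr0Pnorm_le => e e0.
    near=> h.
    have hN0 : h != 0 by near: h; exact: nbhs_dnbhs_neq.
    rewrite addr0 (flat_le0 _ (lexx 0)) subr0 normrZ normfV.
    rewrite ler_pdivrMl ?normr_gt0//.
    apply: le_trans (PC _) _.
    rewrite {1}/GRing.scale/= mulr1 -real_normK ?num_real// expr2 mulrA mulrC.
    rewrite ler_wpM2l// -[e](@mulfVK _ (C + 1)) ?gt_eqF//; last by lra.
    have h1 : `|h| <= e / (C + 1).
      near: h; apply: dnbhs0_le; rewrite divr_gt0//; lra.
    rewrite mulrC.
    apply: (le_trans (y := `|h| * (C + 1))); first by rewrite ler_wpM2l//; lra.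
    by rewrite ler_wpM2r//; lra.
  apply: DeriveDef; first by apply/cvg_ex; exists 0.
  exact/cvg_lim.
Unshelve. all: by end_near. Qed.

(** A class of functions closed under differentiation consists of smooth
    functions. Sums are included because the Leibniz rule produces them. *)
Inductive flat_generated : (R -> R) -> Prop :=
| flat_affine P c d : flat_generated (fun x => flat P (c * x + d))
| flat_generatedD f g : flat_generated f -> flat_generated g ->
    flat_generated (f + g)
| flat_generatedM f g : flat_generated f -> flat_generated g ->
    flat_generated (f * g).

Lemma flat_generated_derive f : flat_generated f ->
  exists2 g, flat_generated g & forall x, is_derive x 1 f (g x).
Proof.
elim => {f} [P c d|f g _ [f' kf df] _ [g' kg dg]|f g Kf [f' kf df] Kg [g' kg dg]].
- exists (fun x => flat (c *: ('X^2 * (P - P^`()%R))) (c * x + d)).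
    exact: flat_affine.
  move=> x.
  have da := is_derive_affine c d x.
  have dF := is_derive_flat P (c * x + d).
  have dc := @is_derive1_comp R (flat P) (fun t => c * t + d) x _ _ dF da.
  apply: (is_derive_eq dc).
  rewrite /flat; case: ifP => _; last by rewrite mul0r.
  by rewrite hornerZ; ring.
- exists (f' + g'); first exact: flat_generatedD.
  by move=> x; exact: is_deriveD.
- exists (f * g' + g * f').
    by apply: flat_generatedD; apply: flat_generatedM.
  move=> x; exact: is_deriveM.
Qed.

Lemma flat_generated_derive1n f n : flat_generated f -> flat_generated (derive1n n f).
Proof.
move=> Kf; elim: n => [//|n IHn]; rewrite derive1nS.
have [g Kg dg] := flat_generated_derive IHn.
suff -> : (derive1n n f)^`()%classic = g by [].
by apply/funext => x; rewrite derive1E; apply: derive_val.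
Qed.

Lemma flat_generated_derivable f n x : flat_generated f ->
  derivable (derive1n n f) x 1.
Proof.
move=> Kf; have [g _ dg] := flat_generated_derive (flat_generated_derive1n n Kf).
by have := dg x; case.
Qed.

(** On [(a,b)] this is [exp(-1/(m(x-a))) exp(-1/(m(b-x)))] with [m = n+1], which
    tends to [1] as [n] grows; both factors vanish beyond their endpoint. *)
Definition smooth_bump a b (n : nat) (x : R) : R :=
  flat 1 (n.+1%:R * x + (- n.+1%:R * a)) * flat 1 (- n.+1%:R * x + n.+1%:R * b).

Lemma flat1_ge0 x : 0 <= flat 1 x.
Proof. by rewrite /flat; case: ifP; rewrite // hornerC mul1r expR_ge0. Qed.

Lemma flat1_le1 x : flat 1 x <= 1.
Proof.
rewrite /flat; case: ifP => // x0; rewrite hornerC mul1r.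
by rewrite -[leRHS]expR0 ler_expR oppr_le0 invr_ge0 ltW.
Qed.

Lemma smooth_bump_ge0 a b n x : 0 <= smooth_bump a b n x.
Proof. by rewrite mulr_ge0 ?flat1_ge0. Qed.

Lemma smooth_bump_le1 a b n x : smooth_bump a b n x <= 1.
Proof. by rewrite -[leRHS]mulr1 ler_pM ?flat1_ge0 ?flat1_le1. Qed.

Lemma smooth_bump_out a b n x : ~~ (a < x < b) -> smooth_bump a b n x = 0.
Proof.
have n0 : 0 < n.+1%:R :> R by [].
rewrite negb_and -!leNgt => /orP[xa|bx]; rewrite /smooth_bump.
  by rewrite flat_le0 ?mul0r// mulNr -mulrBr pmulr_rle0// subr_le0.
by rewrite [X in _ * X]flat_le0 ?mulr0// mulNr addrC -mulrBr pmulr_rle0// subr_le0.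
Qed.

Lemma smooth_bump_cvg a b x : smooth_bump a b n x @[n --> \oo] --> (\1_(`]a, b[) x : R).
Proof.
have cvf t : 0 < t -> flat 1 (n.+1%:R * t) @[n --> \oo] --> (1 : R).
  move=> t0.
  rewrite (_ : (fun n => _) = (fun n : nat => expR (- (n.+1%:R^-1 * t^-1)))); last first.
    by apply/funext => n; rewrite flat_gt0 ?mulr_gt0// hornerC mul1r invfM.
  rewrite -[X in _ --> X]expR0.
  apply: continuous_cvg; first exact: continuous_expR.
  rewrite -oppr0 -(mul0r t^-1); apply: cvgN; apply: cvgMl.
  exact: cvg_harmonic.
rewrite indicE; have [/set_mem/= xab|xab] := boolP (x \in _).
  move: xab; rewrite in_itv/= => /andP[ax xb].
  rewrite -[X in _ --> X]mulr1; apply: cvgM.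
    under eq_cvg do rewrite mulNr -mulrBr.
    by apply: cvf; rewrite subr_gt0.
  under eq_cvg do rewrite mulNr addrC -mulrBr.
  by apply: cvf; rewrite subr_gt0.
under eq_cvg => n.
  rewrite smooth_bump_out; last by apply: contra xab => h; rewrite inE/= in_itv.
  over.
exact: cvg_cst.
Qed.

Lemma test_function_bump a b n : 0 < a -> a < b -> b < 1 ->
  test_function (smooth_bump a b n).
Proof.
move=> a0 ab b1.
have sub : closure [set x | smooth_bump a b n x != 0] `<=` `[a, b].
  rewrite [X in _ `<=` X]((closure_id _).1 (@itv_closed _ _ a b)).
  apply: closure_subset => x /=; rewrite in_itv/=; apply: contraNT => xab.
  by rewrite smooth_bump_out//; apply: contra xab => /andP[/ltW-> /ltW->].
split.
- move=> k x; apply: flat_generated_derivable.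
  by apply: flat_generatedM; exact: flat_affine.
- apply: subclosed_compact sub; first exact: closed_closure.
  exact: segment_compact.
- apply: subset_trans sub _ => x; rewrite /unit_itv/= !in_itv/= => /andP[ax xb]; lra.
Qed.

End SmoothBumps.

(** * Almost everywhere uniqueness of weak derivatives *)

Section FundamentalLemma.
Context {R : realType}.
Notation mu := (@lebesgue_measure R).
Implicit Types (g v : R -> R) (a b : R).

Lemma unit_itv_measurable : measurable (unit_itv R).
Proof. exact: measurable_itv. Qed.

Lemma locally_integrable_segment g a b : 0 < a -> b < 1 ->
  locally_integrable (unit_itv R) g -> mu.-integrable `[a, b] (EFin \o g).
Proof.
move=> a0 b1 [mg _ gfin].
have abD : `[a, b] `<=` unit_itv R.
  move=> x; rewrite /unit_itv/= !in_itv/= => /andP[ax xb]; lra.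
apply/integrableP; split; last by apply: gfin => //; exact: segment_compact.
by apply/measurable_EFinP; apply: measurable_funS mg => //; exact: unit_itv_measurable.
Qed.

(** Dominated convergence: the bumps take values in [[0,1]] and vanish outside
    [(a,b)], a set on which [g] is integrable. *)
Lemma Rintegral_bump_cvg g a b : 0 < a -> a < b -> b < 1 ->
  locally_integrable (unit_itv R) g ->
  \int[mu]_(x in unit_itv R) (g x * smooth_bump a b n x) @[n --> \oo] -->
  \int[mu]_(x in `]a, b[) g x.
Proof.
move=> a0 ab b1 lg.
have ig : mu.-integrable `]a, b[ (EFin \o g).
  apply: integrableS (locally_integrable_segment a0 b1 lg) => //.
  exact: subset_itv_oo_cc.
have mg : measurable_fun `]a, b[ g by apply/measurable_EFinP; case/integrableP: ig.
have abD : `]a, b[ `<=` unit_itv R.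
  move=> x; rewrite /unit_itv/= !in_itv/= => /andP[ax xb]; lra.
rewrite (_ : (fun n => _) =
    (fun n => \int[mu]_(x in `]a, b[) (g x * smooth_bump a b n x))); last first.
  apply/funext => n; rewrite Rintegral_mkcond [RHS]Rintegral_mkcond.
  congr (Rintegral _ _ _); apply/funext => x; rewrite !patchE.
  have [xab|xab] := boolP (x \in `]a, b[%classic).
    by rewrite mem_set//; apply: abD; exact: set_mem.
  case: ifP => // _; rewrite smooth_bump_out ?mulr0//.
  by apply: contra xab => xab; rewrite inE/= in_itv.
have mbump n : measurable_fun `]a, b[ (smooth_bump a b n).
  apply: measurable_funTS; apply: continuous_measurable_fun => x.
  apply/differentiable_continuous/derivable1_diffP.
  by have [/(_ 0%N x)] := test_function_bump n a0 ab b1.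
have cvf : {ae mu, forall x, x \in `]a, b[ ->
    (g x * smooth_bump a b n x)%:E @[n --> \oo] --> (EFin \o g) x}.
  apply: aeW => /= x xab; apply: cvg_EFin; first exact: nearW.
  rewrite /comp/= -[X in _ --> X]mulr1; apply: cvgMr.
  have -> : 1 = \1_(`]a, b[%classic) x :> R by rewrite indicE mem_set.
  exact: smooth_bump_cvg.
have dom : {ae mu, forall x n, x \in `]a, b[ ->
    (`|(g x * smooth_bump a b n x)%:E| <= `|(EFin \o g) x|)%E}.
  apply: aeW => /= x n xab; rewrite lee_fin normrM ler_piMr//.
  by rewrite ger0_norm ?smooth_bump_ge0 ?smooth_bump_le1.
have [_ _ cvd] := @dominated_convergence _ _ _ mu `]a, b[ (measurable_itv _)
  (fun n x => (g x * smooth_bump a b n x)%:E) (EFin \o g) (fun x => `|(EFin \o g) x|%E)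
  (fun n => (measurable_EFinP _ _).2 (measurable_funM mg (mbump n)))
  ((measurable_EFinP _ _).2 mg) cvf (integrable_abse ig) dom.
rewrite /Rintegral; apply: fine_cvg.
by rewrite fineK//; exact: integrable_fin_num.
Qed.

Lemma weak_derivative_Rintegral v g1 g2 a b :
  is_weak_derivative v g1 -> is_weak_derivative v g2 ->
  0 < a -> a < b -> b < 1 ->
  \int[mu]_(x in `]a, b[) g1 x = \int[mu]_(x in `]a, b[) g2 x.
Proof.
move=> [_ lg1 w1] [_ lg2 w2] a0 ab b1.
have c1 := Rintegral_bump_cvg a0 ab b1 lg1.
have c2 := Rintegral_bump_cvg a0 ab b1 lg2.
suff e : (fun n => \int[mu]_(x in unit_itv R) (g1 x * smooth_bump a b n x)) =
    (fun n => \int[mu]_(x in unit_itv R) (g2 x * smooth_bump a b n x)).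
  by rewrite e in c1; exact: (cvg_unique _ c1 c2).
apply/funext => n; have tb := test_function_bump n a0 ab b1.
by apply: oppr_inj; rewrite -w1// -w2.
Qed.

(** The primitive of the difference of two weak derivatives vanishes on every
    compact subinterval, and by Lebesgue's differentiation theorem an integrable
    function is a.e. the derivative of its primitive. *)
Lemma weak_derivative_ae_unique v g1 g2 :
  is_weak_derivative v g1 -> is_weak_derivative v g2 ->
  ae_eq mu (unit_itv R) g1 g2.
Proof.
move=> w1 w2.
(* local integrability only controls compact subintervals, so exhaust *)
suff H : forall n : nat, {ae mu, forall x, x \in `](n.+3%:R^-1 : R), 1 - n.+3%:R^-1[ ->
    g1 x = g2 x}.
  move/ae_foralln : H; apply: filterS => x /= H.
  rewrite /unit_itv/= in_itv/= => /andP[x0 x1].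
  have m0 : 0 < Num.min x (1 - x) by rewrite lt_min x0 subr_gt0.
  have [n _ nP] := near_infty_natSinv_lt (PosNum m0).
  have := nP n.+2 (leq_trans (leqnSn _) (leqnSn _)); rewrite /= lt_min => /andP[nx nx1].
  by apply: (H n); rewrite in_itv/= nx/= ltrBrDr -ltrBrDl.
move=> n; set a := n.+3%:R^-1; set b := 1 - a.
have a0 : 0 < a by rewrite invr_gt0.
have b1 : b < 1 by rewrite /b; lra.
have [_ lg1 _] := w1; have [_ lg2 _] := w2.
have i1 := locally_integrable_segment a0 b1 lg1.
have i2 := locally_integrable_segment a0 b1 lg2.
pose d := fun x => g1 x - g2 x.
have id : mu.-integrable `[a, b] (EFin \o d).
  by apply: eq_integrable (integrableB _ i1 i2) => //; exact: measurable_itv.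
pose f := d \_ `[a, b].
have ifT : mu.-integrable setT (EFin \o f).
  by rewrite /f -restrict_EFin -integrable_mkcond.
have ifs y : mu.-integrable [set` Interval (BLeft a) (BRight y)] (EFin \o f).
  exact: integrableS ifT.
have := FTC1 ifs (integrable_locally (measurable_itv _) id).
apply: filterS; first exact: (ae_filter_ringOfSetsType mu).
move=> x + xab; move: (xab); rewrite in_itv/= => /andP[ax xb].
rewrite lte_fin ax => /(_ isT)[_].
set F := fun y : R => _ => Fx.
apply/eqP; rewrite -subr_eq0 -/(d x).
have -> : d x = f x by rewrite /f patchE mem_set//; exact: subset_itv_oo_cc xab.
rewrite -Fx; apply/eqP.
suff nF : \forall y \near x, F y = cst 0 y.
  by rewrite derive1E (near_eq_derive _ nF) -derive1E derive1_cst.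
near=> y.
have ay : a < y by near: y; exact: lt_nbhsr.
have yb : y < b by near: y; exact: lt_nbhsl.
rewrite /F/=.
have -> : \int[mu]_(t in `[a, y]) f t = \int[mu]_(t in `]a, y[) d t.
  rewrite -Rintegral_itv_bndo_bndc//; last first.
    by apply: integrableS (ifs y) => //; exact: subset_itv_co_cc.
  rewrite -Rintegral_itv_obnd_cbnd//; last first.
    by apply: integrableS (ifs y) => //; exact: subset_itv_oo_cc.
  apply: eq_Rintegral => t; rewrite inE/= in_itv/= => /andP[at_ ty].
  rewrite /f patchE mem_set//= in_itv/= (ltW at_)/=; lra.
have sub : `]a, y[ `<=` `[a, b].
  move=> t /=; rewrite !in_itv/= => /andP[at_ ty]; lra.
rewrite RintegralB//; [|exact: integrableS i1|exact: integrableS i2].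
by rewrite (weak_derivative_Rintegral w1 w2 a0 ay (lt_trans yb b1)) subrr.
Unshelve. all: by end_near. Qed.

End FundamentalLemma.

(** * Weak derivatives of piecewise affine functions *)

Section StepFunctions.
Context {R : realType}.
Notation mu := (@lebesgue_measure R).
Implicit Types (x y : R) (N k l : nat) (a : nat -> R) (f g v phi : R -> R).

(** Half-open cells partition [[0,1)], so that the value of a step function at a
    mesh point is unambiguous. *)
Definition cell N k : set R := `[mesh_point R N k, mesh_point R N k.+1[.

Definition step N a x : R := \sum_(k < N) a k * \1_(cell N k) x.

Lemma mesh_point0 N : mesh_point R N 0 = 0.
Proof. by rewrite /mesh_point mul0r. Qed.

Lemma mesh_pointN N : (0 < N)%N -> mesh_point R N N = 1.
Proof. by move=> N0; rewrite /mesh_point /mesh_size mulfV// pnatr_eq0 gtn_eqF. Qed.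

Lemma mesh_size_gt0 N : (0 < N)%N -> 0 < mesh_size R N.
Proof. by move=> N0; rewrite /mesh_size invr_gt0 ltr0n. Qed.

Lemma mesh_point_ge0 N k : 0 <= mesh_point R N k.
Proof. by rewrite /mesh_point /mesh_size mulr_ge0// invr_ge0. Qed.

Lemma mesh_point_ltS N k : (0 < N)%N -> mesh_point R N k < mesh_point R N k.+1.
Proof. by move=> N0; rewrite /mesh_point ltr_pM2r ?mesh_size_gt0// ltr_nat. Qed.

Lemma mesh_pointB N k : mesh_point R N k.+1 - mesh_point R N k = mesh_size R N.
Proof. by rewrite /mesh_point -mulrBl -natr1 addrAC subrr add0r mul1r. Qed.

Lemma mesh_point_le1 N k : (0 < N)%N -> (k <= N)%N -> mesh_point R N k <= 1.
Proof.
move=> N0 kN; rewrite -(mesh_pointN N0) /mesh_point.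
by rewrite ler_pM2r ?mesh_size_gt0// ler_nat.
Qed.

Lemma measurable_cell N k : measurable (cell N k).
Proof. exact: measurable_itv. Qed.

Lemma cell_scaled N k x : (0 < N)%N ->
  cell N k x <-> k%:R <= x * N%:R < k.+1%:R.
Proof.
move=> N0; rewrite /cell/= in_itv/= /mesh_point /mesh_size.
by rewrite ler_pdivrMr ?ltr0n// ltr_pdivlMr ?ltr0n//.
Qed.

Lemma cell_inj N k l x : (0 < N)%N -> cell N k x -> cell N l x -> k = l.
Proof.
move=> N0 /(cell_scaled _ _ N0)/andP[k1 k2] /(cell_scaled _ _ N0)/andP[l1 l2].
have := le_lt_trans k1 l2; have := le_lt_trans l1 k2; rewrite !ltr_nat !ltnS => lk kl.
by apply/eqP; rewrite eqn_leq lk kl.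
Qed.

Lemma exists_cell N x : (0 < N)%N -> 0 <= x < 1 -> exists2 k, (k < N)%N & cell N k x.
Proof.
move=> N0 /andP[x0 x1]; have xN : 0 <= x * N%:R by rewrite mulr_ge0.
have /andP[t1 t2] := truncn_itv xN.
exists (Num.truncn (x * N%:R)); last by apply/cell_scaled => //; rewrite t1.
rewrite -(ltr_nat R); apply: le_lt_trans t1 _.
by rewrite gtr_pMl ?ltr0n.
Qed.

Lemma step_cell N a k x : (k < N)%N -> cell N k x -> step N a x = a k.
Proof.
move=> kN xk; have N0 := leq_ltn_trans (leq0n _) kN.
rewrite /step (bigD1 (Ordinal kN))//= indicE mem_set// mulr1.
rewrite big1 ?addr0// => l lk; rewrite indicE memNset ?mulr0// => xl.
by move/eqP: lk; apply; apply/val_inj => /=; exact: cell_inj xl xk.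
Qed.

Lemma step_norm_powR (p : R) N a x : (0 < N)%N -> 0 <= x < 1 ->
  `|step N a x| `^ p = step N (fun k => `|a k| `^ p) x.
Proof.
by move=> N0 /(exists_cell N0)[k kN xk]; rewrite !(step_cell _ kN xk).
Qed.

Lemma measurable_step N a : measurable_fun setT (step N a).
Proof.
rewrite /step; apply: measurable_sum => k.
apply: measurable_funM; first exact: measurable_cst.
by apply: measurable_indic; exact: measurable_cell.
Qed.

Lemma step_norm_le N a x : `|step N a x| <= \sum_(k < N) `|a k|.
Proof.
apply: le_trans (ler_norm_sum _ _ _) _; apply: ler_sum => k _.
by rewrite normrM indicE ler_piMr//; case: (_ \in _); rewrite ?normr0 ?normr1.
Qed.

Lemma step_bounded N a (A : set R) : [bounded step N a x | x in A].
Proof.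
exists (\sum_(k < N) `|a k|); split; first exact: num_real.
by move=> M aM x _; exact: le_trans (step_norm_le _ _ _) (ltW aM).
Qed.

Lemma continuous_segment_bounded f b c : continuous f ->
  [bounded f x | x in `[b, c]].
Proof.
move=> cf; have /compact_bounded[M [Mr MP]] : compact (f @` `[b, c]).
  apply: continuous_compact; last exact: segment_compact.
  exact: continuous_subspaceT.
by exists M; split => // t Mt x xbc; apply: MP => //; exists x.
Qed.

Lemma continuous_integrable01 f : {within `[0, 1], continuous f} ->
  mu.-integrable `[0, 1] (EFin \o f).
Proof.
by move=> cf; apply: continuous_compact_integrable => //; exact: segment_compact.
Qed.

Lemma unit_itv_sub01 : unit_itv R `<=` `[0, 1].
Proof. exact: subset_itv_oo_cc. Qed.

Lemma integrable_mul01 f phi : mu.-integrable `[0, 1] (EFin \o f) ->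
  continuous phi -> mu.-integrable `[0, 1] (EFin \o (fun x => f x * phi x)).
Proof.
move=> fi cphi; have mphi : measurable_fun (`[0, 1]%classic : set R) phi.
  by apply: measurable_funTS; exact: continuous_measurable_fun.
by apply: eq_integrable (integrableMl _ fi mphi (continuous_segment_bounded _ _ cphi)) => //;
  exact: measurable_itv.
Qed.

Lemma integrable_step01 N a : mu.-integrable `[0, 1] (EFin \o step N a).
Proof.
apply: measurable_bounded_integrable => //=.
- by rewrite lebesgue_measure_itv/=; case: ifP => _; rewrite ?ltry// -EFinB ltry.
- by apply: measurable_funTS; exact: measurable_step.
- exact: step_bounded.
Qed.

Lemma affine_closed_itv v b c (s t : R) : b < c ->
  {within `[b, c], continuous v} ->
  {in `]b, c[, forall x, v x = s * x + t} ->
  {in `[b, c], forall x, v x = s * x + t}.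
Proof.
move=> bc /(continuous_within_itvP _ bc)[_ vb vc] vst x.
have cw : continuous (fun x => s * x + t).
  by move=> z; apply: cvgD; [apply: cvgMr; exact: cvg_id|exact: cvg_cst].
rewrite in_itv/= le_eqVlt => /andP[/predU1P[<-|bx]].
  move=> _; apply: cvg_unique vb _ => //.
  apply: cvg_trans (cvg_at_right_filter (cw b)); apply: near_eq_cvg.
  near=> y; rewrite vst// in_itv/=; apply/andP; split => //.
rewrite le_eqVlt => /predU1P[->|xc]; last by rewrite vst// in_itv/= bx.
apply: cvg_unique vc _ => //.
apply: cvg_trans (cvg_at_left_filter (cw c)); apply: near_eq_cvg.
near=> y; rewrite vst// in_itv/=; apply/andP; split => //.
Unshelve. all: by end_near. Qed.

Lemma test_function_continuous phi : test_function phi ->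
  continuous phi /\ continuous (derive1 phi).
Proof.
case=> d _ _; split => x; apply/differentiable_continuous/derivable1_diffP.
  exact: d 0%N x.
exact: d 1%N x.
Qed.

Lemma test_function_out phi x : test_function phi -> ~ unit_itv R x -> phi x = 0.
Proof.
case=> _ _ sub xD; apply/eqP; apply: contrapT => /negP px.
by apply/xD/sub/subset_closure.
Qed.

(** The integrand is the derivative of [(s x + t) phi]. *)
Lemma affine_parts_itv phi b c (s t : R) : b < c -> test_function phi ->
  \int[mu]_(x in `[b, c]) ((s * x + t) * derive1 phi x + s * phi x) =
  (s * c + t) * phi c - (s * b + t) * phi b.
Proof.
move=> bc tphi; have [cphi cphi'] := test_function_continuous tphi.
have dphi x : is_derive x 1 phi (derive1 phi x).
  by case: tphi => /(_ 0%N x) d _ _; rewrite derive1E; exact: derivableP.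
have cw : continuous (fun x => s * x + t).
  by move=> z; apply: cvgD; [apply: cvgMr; exact: cvg_id|exact: cvg_cst].
have dw := is_derive_affine s t.
pose F : R -> R := fun x => (s * x + t) * phi x.
have dF x : is_derive x 1 F ((s * x + t) * derive1 phi x + s * phi x).
  apply: (is_derive_eq (is_deriveM (dw x) (dphi x))).
  by rewrite /GRing.scale/= [phi x * s]mulrC.
have cF : continuous F by move=> z; apply: cvgM; [exact: cw|exact: cphi].
rewrite /Rintegral (@continuous_FTC2 _ _ F)//.
- apply: continuous_subspaceT => z; apply: cvgD.
    by apply: cvgM; [exact: cw|exact: cphi'].
  by apply: cvgMr; exact: cphi.
- split; first by move=> x _; exact: ex_derive.
    by apply: cvg_at_right_filter; exact: cF.
  by apply: cvg_at_left_filter; exact: cF.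
- by move=> x _; rewrite derive1E; exact: derive_val.
Qed.

(** Affinity on the open cells extends to the closed ones by continuity, which
    is where the values at mesh points shared by two cells get matched. *)
Lemma X_h_slopes N v : (0 < N)%N -> X_h N v -> exists a, exists b : nat -> R,
  forall k, (k < N)%N ->
    {in `[mesh_point R N k, mesh_point R N k.+1], forall x, v x = a k * x + b k}.
Proof.
move=> N0 [cv aff _ _].
have /choice[ab abP] : forall k : nat, exists ab : R * R, (k < N)%N ->
    {in `[mesh_point R N k, mesh_point R N k.+1], forall x, v x = ab.1 * x + ab.2}.
  move=> k; have [kN|] := boolP (k < N)%N; last by exists (0, 0).
  have [s [t st]] := aff _ kN; exists (s, t) => _ /=.
  apply: affine_closed_itv => //; first exact: mesh_point_ltS.
  apply: continuous_subspaceW cv => x /=; rewrite !in_itv/= => /andP[kx xk].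
  by rewrite (le_trans (mesh_point_ge0 _ _) kx) (le_trans xk)// mesh_point_le1.
by exists (fun k => (ab k).1), (fun k => (ab k).2) => k kN; exact: abP.
Qed.

(** Integrating by parts cell by cell, the boundary terms telescope because [v]
    is continuous across mesh points; the two remaining ones vanish with the
    test function. *)
Lemma step_weak_derivative N v a b : (0 < N)%N -> {within `[0, 1], continuous v} ->
  (forall k, (k < N)%N ->
    {in `[mesh_point R N k, mesh_point R N k.+1], forall x, v x = a k * x + b k}) ->
  is_weak_derivative v (step N a).
Proof.
move=> N0 cv vab; have iv := continuous_integrable01 cv.
have ia := integrable_step01 N a.
have oD : open (unit_itv R) by exact: interval_open.
have mD := @unit_itv_measurable R.
have m01 : measurable (`[0, 1]%classic : set R) by exact: measurable_itv.
split.
- by apply: open_integrable_locally => //; apply: integrableS iv => //; exact: unit_itv_sub01.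
- by apply: open_integrable_locally => //; apply: integrableS ia => //; exact: unit_itv_sub01.
move=> phi tphi; have [cphi cphi'] := test_function_continuous tphi.
have ivp := integrable_mul01 iv cphi'; have iap := integrable_mul01 ia cphi.
apply/eqP; rewrite -addr_eq0; apply/eqP.
rewrite -RintegralD//; last 2 first.
- by apply: integrableS ivp => //; exact: unit_itv_sub01.
- by apply: integrableS iap => //; exact: unit_itv_sub01.
pose H x := v x * derive1 phi x + step N a x * phi x.
have iH : mu.-integrable `[0, 1] (EFin \o H).
  by apply: eq_integrable (integrableD _ ivp iap).
have sub01 k : (k <= N)%N -> `[0, mesh_point R N k[ `<=` `[0, 1].
  move=> kN x /=; rewrite !in_itv/= => /andP[-> xk].
  by rewrite (le_trans (ltW xk))// mesh_point_le1.
have telescope k : (k <= N)%N ->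
    \int[mu]_(x in `[0, mesh_point R N k[) H x =
    v (mesh_point R N k) * phi (mesh_point R N k).
  elim: k => [_|k IHk kN].
    rewrite mesh_point0 set_itv_ge ?bnd_simp ?ltxx// Rintegral_set0.
    by rewrite (test_function_out tphi) ?mulr0// /unit_itv/= in_itv/= ltxx.
  have kS := mesh_point_ltS k N0.
  have split_itv : `[0, mesh_point R N k.+1[%classic =
      `[0, mesh_point R N k[ `|` cell N k.
    by rewrite -itv_bndbnd_setU//; rewrite bnd_simp ?mesh_point_ge0// ltW.
  have ik : mu.-integrable (`[0, mesh_point R N k[ `|` cell N k) (EFin \o H).
    by rewrite -split_itv; apply: integrableS iH => //; exact: sub01.
  have mk := measurable_cell N k.
  rewrite split_itv Rintegral_setU//; last first.
    apply/disj_setPS => x [/=]; rewrite /cell/= !in_itv/= => /andP[_ xk] /andP[kx _].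
    by move: (lt_le_trans xk kx); rewrite ltxx.
  rewrite (IHk (ltnW kN)).
  have kc : mesh_point R N k \in `[mesh_point R N k, mesh_point R N k.+1].
    by rewrite in_itv/= lexx ltW.
  have kSc : mesh_point R N k.+1 \in `[mesh_point R N k, mesh_point R N k.+1].
    by rewrite in_itv/= lexx ltW.
  rewrite (vab _ kN _ kc) (vab _ kN _ kSc).
  have -> : \int[mu]_(x in cell N k) H x =
     \int[mu]_(x in cell N k) ((a k * x + b k) * derive1 phi x + a k * phi x).
    apply: eq_Rintegral => x /set_mem xk; rewrite /H (step_cell _ kN xk) (vab _ kN)//.
    by move: xk; rewrite /cell/=; apply: subset_itv_co_cc.
  rewrite /cell Rintegral_itv_bndo_bndc//; last first.
    have iHk : mu.-integrable (cell N k) (EFin \o H).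
      by apply: integrableS ik => //; exact: measurableU.
    apply: eq_integrable iHk => //.
    move=> x /set_mem xk /=; rewrite /H (step_cell _ kN xk) (vab _ kN)//.
    by move: xk; rewrite /cell/=; apply: subset_itv_co_cc.
  by rewrite affine_parts_itv//; ring.
have i0 : mu.-integrable (unit_itv R) (EFin \o H).
  by apply: integrableS iH => //; exact: unit_itv_sub01.
rewrite -[LHS]/(\int[mu]_(x in `]0, 1[) H x) Rintegral_itv_obnd_cbnd//.
rewrite -(mesh_pointN N0) telescope// mesh_pointN//.
by rewrite (test_function_out tphi) ?mulr0// /unit_itv/= in_itv/= ltxx andbF.
Qed.

End StepFunctions.

(** * Tonelli's theorem on rectangles *)

Section TonelliRectangles.
Context {R : realType}.
Notation mu := (@lebesgue_measure R).
Context (f : R * R -> \bar R) (A B : set R).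
Context (mf : measurable_fun setT f) (f0 : forall z, (0 <= f z)%E).
Context (mA : measurable A) (mB : measurable B).

Let mfAB : measurable_fun setT (f \_ (A `*` B)).
Proof.
apply/(measurable_restrictT _ _).1; first exact: measurableX.
exact: measurable_funTS.
Qed.

Let fAB0 z : (0 <= (f \_ (A `*` B)) z)%E.
Proof. by apply: erestrict_ge0 => ? _. Qed.

Lemma tonelli_rectangle1 : (\int[(mu \x mu)%E]_(z in A `*` B) f z =
  \int[mu]_(x in A) \int[mu]_(y in B) f (x, y))%E.
Proof.
rewrite integral_mkcond [RHS]integral_mkcond.
rewrite [LHS](fubini_tonelli1 (m1 := mu) (m2 := mu) _ mfAB fAB0).
apply: eq_integral => x _; rewrite /fubini_F patchE.
case: ifPn => xA; last first.
  by apply: integral0_eq => y _; rewrite patchE memNset//= => -[/mem_set]; rewrite (negbTE xA).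
rewrite [RHS]integral_mkcond; apply: eq_integral => y _; rewrite !patchE.
by congr (if _ then _ else _); apply/idP/idP => /set_mem h; apply/mem_set;
  [case: h|split; [exact: set_mem|]].
Qed.

Lemma tonelli_rectangle2 : (\int[(mu \x mu)%E]_(z in A `*` B) f z =
  \int[mu]_(y in B) \int[mu]_(x in A) f (x, y))%E.
Proof.
rewrite integral_mkcond [RHS]integral_mkcond.
rewrite [LHS](fubini_tonelli2 (m1 := mu) (m2 := mu) _ mfAB fAB0).
apply: eq_integral => y _; rewrite /fubini_G patchE.
case: ifPn => yB; last first.
  by apply: integral0_eq => x _; rewrite patchE memNset//= => -[_ /mem_set]; rewrite (negbTE yB).
rewrite [RHS]integral_mkcond; apply: eq_integral => x _; rewrite !patchE.
by congr (if _ then _ else _); apply/idP/idP => /set_mem h; apply/mem_set;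
  [case: h|split; [|exact: set_mem]].
Qed.

Lemma measurable_integral_section :
  measurable_fun A (fun x => \int[mu]_(y in B) f (x, y))%E.
Proof.
have := measurable_fun_fubini_tonelli_F (m2 := mu) _ mfAB fAB0 => mF.
have : measurable_fun A (fubini_F mu (f \_ (A `*` B))) by exact: measurable_funTS.
apply: eq_measurable_fun => x xA; rewrite /fubini_F [RHS]integral_mkcond.
apply: eq_integral => y _; rewrite !patchE.
by congr (if _ then _ else _); apply/idP/idP => /set_mem h; apply/mem_set;
  [case: h|split; [exact: set_mem|]].
Qed.

End TonelliRectangles.

(** * The singular kernel over a cell and its complement *)

Section Kernel.
Context {R : realType}.
Notation mu := (@lebesgue_measure R).
Implicit Types (b c q r x y : R).

(** On the diagonal this is [0^-1 = 0], in agreement with the integrand of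
    [W1sp_seminorm]. *)
Definition riesz_kernel q x y : R := (`|x - y| `^ (1 + q))^-1.

Lemma riesz_kernel_ge0 q x y : 0 <= riesz_kernel q x y.
Proof. by rewrite invr_ge0 powR_ge0. Qed.

Lemma riesz_kernelC q x y : riesz_kernel q x y = riesz_kernel q y x.
Proof. by rewrite /riesz_kernel distrC. Qed.

Lemma measurable_riesz_kernel q :
  measurable_fun setT (fun z : R * R => riesz_kernel q z.1 z.2).
Proof.
rewrite /riesz_kernel; under eq_fun do rewrite -powRN.
have m2 : measurable_fun setT (fun z : R * R => `|z.1 - z.2|).
  apply: measurableT_comp => //.
  apply: measurable_funB; [exact: measurable_fst|exact: measurable_snd].
exact: (measurableT_comp (measurable_powR _) m2).
Qed.

Lemma is_derive_powR r x : 0 < x -> is_derive x 1 (@powR R ^~ r) (r * x `^ (r - 1)).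
Proof.
move=> x0; have xi : x \in `]0, +oo[ by rewrite in_itv/= x0.
apply: DeriveDef; first exact: derivable_powR.
by rewrite -derive1E powR_derive1.
Qed.

(** The sign [s] treats distances to a point on the left ([s = 1]) and on the
    right ([s = -1]) of the interval at once. *)
Lemma integral_powR_affine (s x0 : R) r b c : s * s = 1 -> r != 0 -> b < c ->
  (forall y, b <= y <= c -> 0 < s * (y - x0)) ->
  (\int[mu]_(y in `[b, c]) ((s * (y - x0)) `^ (r - 1))%:E =
   (s / r * (s * (c - x0)) `^ r)%:E - (s / r * (s * (b - x0)) `^ r)%:E)%E.
Proof.
move=> ss r0 bc pos.
have dw y : is_derive y 1 (fun y => s * (y - x0)) s.
  have d1 : is_derive y 1 (fun y => y - x0) 1.
    by apply: (is_derive_eq (is_deriveB (is_derive_id y 1) (is_derive_cst x0 y 1))); rewrite subr0.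
  by apply: (is_derive_eq (is_deriveZ s d1)); exact: mulr1.
have dp t y : b <= y <= c -> is_derive y 1 (fun y => (s * (y - x0)) `^ t)
    (t * (s * (y - x0)) `^ (t - 1) * s).
  move=> ybc; have := is_derive_powR t (pos _ ybc).
  by move=> d; exact: (@is_derive1_comp R (@powR R ^~ t) (fun y => s * (y - x0)) y _ _ d (dw y)).
have dF y : b <= y <= c -> is_derive y 1 (fun y => s / r * (s * (y - x0)) `^ r)
    ((s * (y - x0)) `^ (r - 1)).
  move=> ybc; apply: (is_derive_eq (is_deriveZ (s / r) (dp r _ ybc))).
  rewrite /GRing.scale/= mulrA mulrAC mulrA [X in X * _ = _](_ : _ = s * s).
    by rewrite ss mul1r.
  by rewrite [RHS]mulrC; field.
have cont (f : R -> R) (d : R) y : is_derive y 1 f d -> f z @[z --> y] --> f y.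
  by case=> df _; exact/differentiable_continuous/derivable1_diffP.
have bbc : b <= b <= c by rewrite lexx ltW.
have cbc : b <= c <= c by rewrite lexx ltW.
have sub y : y \in `]b, c[ -> b <= y <= c.
  by rewrite in_itv/= => /andP[/ltW -> /ltW ->].
rewrite (@continuous_FTC2 _ _ (fun y => s / r * (s * (y - x0)) `^ r))//.
- apply/continuous_within_itvP => //; split.
  + by move=> y /sub ybc; exact: cont (dp _ _ ybc).
  + by apply: cvg_at_right_filter; exact: cont (dp _ _ bbc).
  + by apply: cvg_at_left_filter; exact: cont (dp _ _ cbc).
- split.
  + by move=> y /sub ybc; have [] := dF y ybc.
  + by apply: cvg_at_right_filter; exact: cont (dF _ bbc).
  + by apply: cvg_at_left_filter; exact: cont (dF _ cbc).
- by move=> y /sub ybc; rewrite derive1E; have dy := dF y ybc; exact: derive_val.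
Qed.

Lemma integral_riesz_kernel_right q x b c : 0 < q -> x < b ->
  (\int[mu]_(y in `[b, c]) (riesz_kernel q x y)%:E <= ((b - x) `^ (- q) / q)%:E)%E.
Proof.
move=> q0 xb; have rhs0 : (0 <= ((b - x) `^ (- q) / q)%:E)%E.
  by rewrite lee_fin divr_ge0 ?powR_ge0// ltW.
have [bc|cb|bc] := ltgtP b c; last 2 first.
- by rewrite set_itv_ge ?integral_set0// bnd_simp -ltNge.
- by rewrite -bc set_itv1 integral_set1.
have pos y : b <= y <= c -> 0 < 1 * (y - x).
  by move=> /andP[by_ _]; rewrite mul1r subr_gt0 (lt_le_trans xb).
have -> : (\int[mu]_(y in `[b, c]) (riesz_kernel q x y)%:E =
    \int[mu]_(y in `[b, c]) ((1 * (y - x)) `^ (- q - 1))%:E)%E.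
  apply: eq_integral.
  move=> y /set_mem/=; rewrite in_itv/= => /pos; rewrite mul1r => yx.
  by rewrite /riesz_kernel distrC gtr0_norm// -powRN opprD [- 1 - q]addrC.
rewrite integral_powR_affine ?mulr1 ?oppr_eq0 ?gt_eqF//.
rewrite -EFinB lee_fin !mul1r invrN !mulNr opprK addrC [leRHS]mulrC.
by rewrite gerBl mulr_ge0 ?invr_ge0 ?powR_ge0// ltW.
Qed.

Lemma integral_riesz_kernel_left q x b c : 0 < q -> c < x ->
  (\int[mu]_(y in `[b, c]) (riesz_kernel q x y)%:E <= ((x - c) `^ (- q) / q)%:E)%E.
Proof.
move=> q0 cx; have rhs0 : (0 <= ((x - c) `^ (- q) / q)%:E)%E.
  by rewrite lee_fin divr_ge0 ?powR_ge0// ltW.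
have [bc|cb|bc] := ltgtP b c; last 2 first.
- by rewrite set_itv_ge ?integral_set0// bnd_simp -ltNge.
- by rewrite bc set_itv1 integral_set1.
have pos y : b <= y <= c -> 0 < -1 * (y - x).
  by move=> /andP[_ yc]; rewrite mulN1r opprB subr_gt0 (le_lt_trans yc).
have -> : (\int[mu]_(y in `[b, c]) (riesz_kernel q x y)%:E =
    \int[mu]_(y in `[b, c]) ((-1 * (y - x)) `^ (- q - 1))%:E)%E.
  apply: eq_integral.
  move=> y /set_mem/=; rewrite in_itv/= => /pos; rewrite mulN1r opprB => yx.
  by rewrite /riesz_kernel gtr0_norm// -powRN opprD [- 1 - q]addrC.
rewrite integral_powR_affine ?mulN1r ?opprK ?oppr_eq0 ?gt_eqF//.
rewrite -EFinB lee_fin invrN opprK !opprB [leRHS]mulrC.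
by rewrite gerBl mulr_ge0 ?invr_ge0 ?powR_ge0// ltW.
Qed.

(** Monotone convergence: for a nonnegative function, possibly singular at the
    endpoints, it suffices to bound the integrals over compact subintervals. *)
Lemma integral_oo_le (f : R -> \bar R) (M : \bar R) b c : b < c ->
  measurable_fun `]b, c[ f -> (forall x, (0 <= f x)%E) ->
  (forall b' c', b < b' -> b' < c' -> c' < c ->
     (\int[mu]_(x in `[b', c']) f x <= M)%E) ->
  (\int[mu]_(x in `]b, c[) f x <= M)%E.
Proof.
move=> bc mf f0 fM.
(* with denominators at least 3 the trimmed intervals are nondegenerate *)
pose e (n : nat) : R := (c - b) / n.+3%:R.
have e0 n : 0 < e n by rewrite divr_gt0 ?subr_gt0.
have e3 n : e n * 3 <= c - b.
  rewrite /e mulrAC ler_pdivrMr// ler_wpM2l ?subr_ge0 ?(ltW bc)//.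
  by rewrite ler_nat.
pose F n : set R := `[b + e n, c - e n]%classic.
have FU : \bigcup_n F n = `]b, c[%classic.
  apply/seteqP; split => [x [n _]|x].
    rewrite /F/= !in_itv/= => /andP[bx xc]; have := e0 n => en.
    by apply/andP; split; lra.
  rewrite /= in_itv/= => /andP[bx xc].
  have m0 : 0 < Num.min (x - b) (c - x) / (c - b).
    by rewrite divr_gt0 ?subr_gt0// lt_min !subr_gt0 bx.
  have [n _ nP] := near_infty_natSinv_lt (PosNum m0).
  have := nP n.+2 (leq_trans (leqnSn _) (leqnSn _)).
  rewrite /= ltr_pdivlMr ?subr_gt0// mulrC lt_min -/(e n) => /andP[e1 e2].
  by exists n => //; rewrite /F/= in_itv/=; apply/andP; split; lra.
have Fsub n : F n `<=` `]b, c[ by rewrite -FU; exact: bigcup_sup.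
have ndF : nondecreasing_seq F.
  apply/nondecreasing_seqP => n; apply/subsetPset => x.
  have en : e n.+1 <= e n.
    by rewrite /e ler_wpM2l ?subr_ge0 ?(ltW bc)// lef_pV2 ?posrE// ler_nat.
  rewrite /F/= !in_itv/= => /andP[h1 h2]; apply/andP; split; lra.
have cv : (\int[mu]_(x in F n) f x @[n --> \oo] --> \int[mu]_(x in `]b, c[) f x)%E.
  rewrite -FU; apply: ge0_nondecreasing_set_cvg_integral => //.
    by move=> n; exact: measurable_itv.
  by move=> n; apply: measurable_funS mf => //; exact: measurable_itv.
rewrite -(cvg_lim _ cv)//.
apply: lime_le; first by apply/cvg_ex; eexists; exact: cv.
apply: nearW => n; have := e0 n; have := e3 n => h1 h2.
by apply: fM; lra.
Qed.

Lemma measurable_EFin_powR (g : R -> R) r (A : set R) : measurable_fun setT g ->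
  measurable_fun A (fun x => (g x `^ r)%:E).
Proof.
move=> mg; apply/measurable_EFinP; apply: measurable_funTS.
exact: (measurableT_comp (measurable_powR _) mg).
Qed.

Lemma measurable_subl (t : R) : measurable_fun setT (fun x : R => x - t).
Proof. by apply: measurable_funB; [exact: measurable_id|exact: measurable_cst]. Qed.

Lemma measurable_subr (t : R) : measurable_fun setT (fun x : R => t - x).
Proof. by apply: measurable_funB; [exact: measurable_cst|exact: measurable_id]. Qed.

Lemma integral_powR_from_left q b c : q < 1 -> b < c ->
  (\int[mu]_(x in `]b, c[) ((x - b) `^ (- q))%:E <=
   ((c - b) `^ (1 - q) / (1 - q))%:E)%E.
Proof.
move=> q1 bc; have p1 : 0 < 1 - q by rewrite subr_gt0.
have E x : (x - b) `^ (- q) = (1 * (x - b)) `^ (1 - q - 1).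
  by rewrite mul1r addrAC subrr add0r.
under eq_integral do rewrite E.
apply: integral_oo_le => //; first apply: measurable_EFin_powR.
    by apply: measurable_funM; [exact: measurable_cst|exact: measurable_subl].
  by move=> x; rewrite lee_fin powR_ge0.
move=> b' c' bb' bc' cc'.
rewrite integral_powR_affine ?mulr1 ?gt_eqF//; last first.
  by move=> y /andP[h1 h2]; rewrite mul1r subr_gt0 (lt_le_trans bb').
rewrite -EFinB lee_fin !mul1r [leRHS]mulrC -mulrBr ler_pM2l ?invr_gt0//.
apply: (le_trans (y := (c' - b) `^ (1 - q))).
  by rewrite gerBl powR_ge0.
apply: ge0_ler_powR; rewrite ?nnegrE; lra.
Qed.

Lemma integral_powR_from_right q b c : q < 1 -> b < c ->
  (\int[mu]_(x in `]b, c[) ((c - x) `^ (- q))%:E <=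
   ((c - b) `^ (1 - q) / (1 - q))%:E)%E.
Proof.
move=> q1 bc; have p1 : 0 < 1 - q by rewrite subr_gt0.
have E x : (c - x) `^ (- q) = (-1 * (x - c)) `^ (1 - q - 1).
  by rewrite mulN1r opprB addrAC subrr add0r.
under eq_integral do rewrite E.
apply: integral_oo_le => //; first apply: measurable_EFin_powR.
    by apply: measurable_funM; [exact: measurable_cst|exact: measurable_subl].
  by move=> x; rewrite lee_fin powR_ge0.
move=> b' c' bb' bc' cc'.
rewrite integral_powR_affine ?mulN1r ?opprK ?gt_eqF//; last first.
  by move=> y /andP[h1 h2]; rewrite mulN1r opprB subr_gt0 (le_lt_trans h2).
rewrite -EFinB lee_fin !opprB !mulNr opprK addrC.
rewrite [leRHS]mulrC -mulrBr ler_pM2l ?invr_gt0//.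
apply: (le_trans (y := (c - b') `^ (1 - q))).
  by rewrite gerBl powR_ge0.
apply: ge0_ler_powR; rewrite ?nnegrE; lra.
Qed.

Lemma measurable_integral_riesz_kernel q (A B : set R) : measurable A -> measurable B ->
  measurable_fun B (fun x => \int[mu]_(y in A) (riesz_kernel q x y)%:E)%E.
Proof.
move=> mA mB; have mk : measurable_fun setT (fun z : R * R => (riesz_kernel q z.1 z.2)%:E).
  by apply/measurable_EFinP; exact: measurable_riesz_kernel.
have k0 (z : R * R) : (0 <= (riesz_kernel q z.1 z.2)%:E)%E by rewrite lee_fin riesz_kernel_ge0.
exact: (measurable_integral_section mk k0 mB mA).
Qed.

(** For [x] in the cell, the kernel integrated over the complement is at most
    [((x-b)^(-q) + (c-x)^(-q)) / q], whose singularities at the endpoints are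
    integrable precisely when [q < 1]. *)
Lemma integral_riesz_kernel_cell q b c : 0 < q -> q < 1 -> 0 <= b -> b < c -> c <= 1 ->
  (\int[mu]_(x in `[b, c[) \int[mu]_(y in unit_itv R `\` `[b, c[) (riesz_kernel q x y)%:E
   <= (2 * ((c - b) `^ (1 - q) / (q * (1 - q))))%:E)%E.
Proof.
move=> q0 q1 b0 bc c1.
have mD := @unit_itv_measurable R.
have mbc : measurable (`[b, c[%classic : set R) by exact: measurable_itv.
have mA : measurable (unit_itv R `\` `[b, c[) by exact: measurableD.
rewrite -integral_itv_obnd_cbnd; last exact: measurable_integral_riesz_kernel.
have mK x (S : set R) : measurable_fun S (fun y => (riesz_kernel q x y)%:E).
  apply/measurable_EFinP; apply: measurable_funTS.
  have := measurable_riesz_kernel q => mk.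
  exact: (measurableT_comp mk (measurable_pair1 x)).
have n1 : measurable_fun `]b, c[ (fun x => ((x - b) `^ (- q))%:E).
  by apply: measurable_EFin_powR; exact: measurable_subl.
have n2 : measurable_fun `]b, c[ (fun x => ((c - x) `^ (- q))%:E).
  by apply: measurable_EFin_powR; exact: measurable_subr.
have m1 : measurable_fun `]b, c[ (fun x => (q^-1 * (x - b) `^ (- q))%:E).
  apply/measurable_EFinP; apply: measurable_funM; first exact: measurable_cst.
  exact/measurable_EFinP.
have m2 : measurable_fun `]b, c[ (fun x => (q^-1 * (c - x) `^ (- q))%:E).
  apply/measurable_EFinP; apply: measurable_funM; first exact: measurable_cst.
  exact/measurable_EFinP.
have p0 (t : R) x : (0 <= (q^-1 * t `^ (- x))%:E)%E.
  by rewrite lee_fin mulr_ge0 ?powR_ge0// invr_ge0 ltW.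
apply: (@le_trans _ _ (\int[mu]_(x in `]b, c[)
    ((q^-1 * (x - b) `^ (- q))%:E + (q^-1 * (c - x) `^ (- q))%:E))%E).
  apply: ge0_le_integral => //.
  - by move=> x _; apply: integral_ge0 => y _; rewrite lee_fin riesz_kernel_ge0.
  - exact: measurable_integral_riesz_kernel.
  - exact: emeasurable_funD.
  move=> x; rewrite /= in_itv/= => /andP[bx xc].
  pose S : set R := `[0, b] `|` `[c, 1].
  have sub : unit_itv R `\` `[b, c[ `<=` S.
    move=> y []; rewrite /S/= !in_itv/= => /andP[y0 y1] /negP.
    rewrite negb_and -ltNge -leNgt => /orP[yb|cy]; [left|right].
      by rewrite (ltW y0) ltW.
    by rewrite cy ltW.
  have le_sub : (\int[mu]_(y in unit_itv R `\` `[b, c[) (riesz_kernel q x y)%:E <=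
      \int[mu]_(y in S) (riesz_kernel q x y)%:E)%E.
    have mS : measurable S by apply: measurableU; exact: measurable_itv.
    apply: ge0_subset_integral => //; first exact: mK.
    by move=> y _; rewrite lee_fin riesz_kernel_ge0.
  apply: le_trans le_sub _.
  have ml : measurable (`[0, b]%classic : set R) by exact: measurable_itv.
  have mr : measurable (`[c, 1]%classic : set R) by exact: measurable_itv.
  rewrite ge0_integral_setU//; last 3 first.
  - exact: mK.
  - by move=> y _; rewrite lee_fin riesz_kernel_ge0.
  - apply/disj_setPS => y [/=]; rewrite !in_itv/= => /andP[_ yb] /andP[cy _].
    by have := lt_le_trans bc (le_trans cy yb); rewrite ltxx.
  apply: leeD.
    by rewrite mulrC; exact: integral_riesz_kernel_left.
  by rewrite mulrC; exact: integral_riesz_kernel_right.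
rewrite ge0_integralD//.
under eq_integral do rewrite EFinM.
under [X in (_ + X)%E]eq_integral do rewrite EFinM.
have qV : 0 <= q^-1 by rewrite invr_ge0 ltW.
rewrite !ge0_integralZl//; [|by move=> x _; rewrite lee_fin powR_ge0..].
have -> : 2 * ((c - b) `^ (1 - q) / (q * (1 - q))) =
    q^-1 * ((c - b) `^ (1 - q) / (1 - q)) + q^-1 * ((c - b) `^ (1 - q) / (1 - q)).
  by field; rewrite !gt_eqF ?subr_gt0.
rewrite EFinD (EFinM q^-1); apply: leeD; apply: lee_wpmul2l; rewrite ?lee_fin//.
- exact: integral_powR_from_left.
- exact: integral_powR_from_right.
Qed.

End Kernel.

(** * The Gagliardo double integral of a step function *)

Section Gagliardo.
Context {R : realType}.
Notation mu := (@lebesgue_measure R).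
Implicit Types (s p q : R) (g v : R -> R) (a : nat -> R) (N k : nat).

Let mD := @unit_itv_measurable R.

(** The [p]-th power of the Gagliardo seminorm, for [q = s p] and [g] in the
    role of the derivative. *)
Definition gagliardo p q g : \bar R :=
  (\int[mu]_(x in unit_itv R) \int[mu]_(y in unit_itv R)
    (`|g x - g y| `^ p * riesz_kernel q x y)%R%:E)%E.

Lemma W1sp_seminormE s p v :
  W1sp_seminorm s p v = (gagliardo p (s * p) (weak_derivative v) `^ p^-1)%E.
Proof. by []. Qed.

Lemma measurable_gagliardo p q g : measurable_fun setT g ->
  measurable_fun setT
    (fun z : R * R => (`|g z.1 - g z.2| `^ p * riesz_kernel q z.1 z.2)%:E).
Proof.
move=> mg; apply/measurable_EFinP.
apply: measurable_funM; last exact: measurable_riesz_kernel.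
have m2 : measurable_fun setT (fun z : R * R => `|g z.1 - g z.2|).
  apply: measurableT_comp => //; apply: measurable_funB.
    exact: (measurableT_comp mg measurable_fst).
  exact: (measurableT_comp mg measurable_snd).
exact: (measurableT_comp (measurable_powR _) m2).
Qed.

Lemma gagliardo_integrand_ge0 p q g x y :
  (0 <= (`|g x - g y| `^ p * riesz_kernel q x y)%:E)%E.
Proof. by rewrite lee_fin mulr_ge0 ?powR_ge0 ?riesz_kernel_ge0. Qed.

Lemma gagliardo_patch p q g :
  gagliardo p q g = gagliardo p q (g \_ (unit_itv R)).
Proof.
apply: eq_integral => x xD; apply: eq_integral => y yD.
by rewrite !patchE xD yD.
Qed.

(** The weak derivative is only known up to a null set; Tonelli's theorem
    supplies the measurability of the inner integrals. *)
Lemma gagliardo_ae_eq p q g1 g2 : measurable_fun (unit_itv R) g1 ->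
  measurable_fun (unit_itv R) g2 -> ae_eq mu (unit_itv R) g1 g2 ->
  gagliardo p q g1 = gagliardo p q g2.
Proof.
move=> m1 m2 e12; rewrite gagliardo_patch [RHS]gagliardo_patch.
set h1 := g1 \_ _; set h2 := g2 \_ _.
have mh1 : measurable_fun setT h1 by apply/(measurable_restrictT _ _).1.
have mh2 : measurable_fun setT h2 by apply/(measurable_restrictT _ _).1.
have h12 : ae_eq mu (unit_itv R) h1 h2.
  apply: filterS e12 => x + xD; rewrite /h1 /h2 !patchE mem_set//; exact.
have mg1 := measurable_gagliardo p q mh1; have mg2 := measurable_gagliardo p q mh2.
have g10 (z : R * R) := gagliardo_integrand_ge0 p q h1 z.1 z.2.
have g20 (z : R * R) := gagliardo_integrand_ge0 p q h2 z.1 z.2.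
apply: ge0_ae_eq_integral => //.
- exact: (measurable_integral_section mg1 g10 mD mD).
- exact: (measurable_integral_section mg2 g20 mD mD).
- by move=> x _; apply: integral_ge0 => y _; exact: gagliardo_integrand_ge0.
- by move=> x _; apply: integral_ge0 => y _; exact: gagliardo_integrand_ge0.
apply: filterS (h12) => x + xD => /(_ xD) ex.
apply: ge0_ae_eq_integral => //.
- by apply: measurable_funTS; exact: (measurableT_comp mg1 (measurable_pair1 x)).
- by apply: measurable_funTS; exact: (measurableT_comp mg2 (measurable_pair1 x)).
- by move=> y _; exact: gagliardo_integrand_ge0.
- by move=> y _; exact: gagliardo_integrand_ge0.
by apply: filterS h12 => y + yD => /(_ yD) ey; rewrite ex ey.
Qed.

(** Bound the difference by twice the larger of the two absolute values. *)
Lemma normB_powR_le p (t u : R) : 0 <= p ->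
  `|t - u| `^ p <= 2 `^ p * (`|t| `^ p + `|u| `^ p).
Proof.
move=> p0.
wlog ut : t u / `|u| <= `|t|.
  move=> H; have [ut|tu] := leP `|u| `|t|; first exact: H.
  by rewrite distrC [X in _ * X]addrC; apply: H; rewrite ltW.
apply: (@le_trans _ _ (2 `^ p * `|t| `^ p)); last first.
  by rewrite ler_wpM2l ?powR_ge0// lerDl powR_ge0.
rewrite -powRM//; apply: ge0_ler_powR; rewrite ?nnegrE ?mulr_ge0//.
by apply: le_trans (ler_normB _ _) _; lra.
Qed.

(** The difference vanishes when [x] and [y] share a cell. Otherwise the two
    terms of [normB_powR_le] are charged to the cell of [x] and to the cell of
    [y] respectively, which decouples the double integral into one integral per
    cell. *)
Lemma gagliardo_step_pointwise p q N a (x y : R) : 0 < p -> (0 < N)%N ->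
  unit_itv R x -> unit_itv R y ->
  `|step N a x - step N a y| `^ p * riesz_kernel q x y <=
  \sum_(k < N) (2 `^ p * `|a k| `^ p) *
    (((fun z => riesz_kernel q z.1 z.2) \_ (cell N k `*` (unit_itv R `\` cell N k))) (x, y) +
     ((fun z => riesz_kernel q z.1 z.2) \_ ((unit_itv R `\` cell N k) `*` cell N k)) (x, y)).
Proof.
move=> p0 N0 xD yD.
have in01 z : unit_itv R z -> 0 <= z < 1.
  by rewrite /unit_itv/= in_itv/= => /andP[/ltW -> ->].
have patch0 (E : set (R * R)) : 0 <= ((fun z => riesz_kernel q z.1 z.2) \_ E) (x, y).
  by rewrite patchE; case: ifP => // _; exact: riesz_kernel_ge0.
have c0 k : 0 <= 2 `^ p * `|a k| `^ p by rewrite mulr_ge0 ?powR_ge0.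
have [k kN xk] := exists_cell N0 (in01 _ xD).
have [l lN yl] := exists_cell N0 (in01 _ yD).
rewrite (step_cell _ kN xk) (step_cell _ lN yl).
have [kl|kl] := eqVneq k l.
  rewrite kl subrr normr0 powR0 ?gt_eqF// mul0r.
  by apply: sumr_ge0 => i _; rewrite mulr_ge0// addr_ge0.
apply: (@le_trans _ _ (2 `^ p * (`|a k| `^ p + `|a l| `^ p) * riesz_kernel q x y)).
  by rewrite ler_wpM2r ?riesz_kernel_ge0// normB_powR_le// ltW.
rewrite mulrDr mulrDl; under eq_bigr do rewrite mulrDr.
rewrite big_split/=; apply: lerD.
- rewrite (bigD1 (Ordinal kN))//= patchE mem_set/=; last first.
    by split => //; split => // yk; move: kl; rewrite (cell_inj N0 yk yl) eqxx.
  by rewrite lerDl; apply: sumr_ge0 => i _; rewrite mulr_ge0.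
- rewrite (bigD1 (Ordinal lN))//= patchE mem_set/=; last first.
    by split => //; split => // xl; move: kl; rewrite (cell_inj N0 xk xl) eqxx.
  by rewrite lerDl; apply: sumr_ge0 => i _; rewrite mulr_ge0.
Qed.

(** The factor [4] counts the two orders of [(x, y)] and the two endpoints of a
    cell. *)
Lemma gagliardo_step_le p q N a : 0 < p -> 0 < q -> q < 1 -> (0 < N)%N ->
  (gagliardo p q (step N a) <=
   (2 `^ p * 4 / (q * (1 - q)) * mesh_size R N `^ (1 - q) *
    \sum_(k < N) `|a k| `^ p)%:E)%E.
Proof.
move=> p0 q0 q1 N0.
have mF := measurable_gagliardo p q (measurable_step N a).
have F0 (z : R * R) := gagliardo_integrand_ge0 p q (step N a) z.1 z.2.
have mk : measurable_fun setT (fun z : R * R => (riesz_kernel q z.1 z.2)%:E).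
  by apply/measurable_EFinP; exact: measurable_riesz_kernel.
have k0 (z : R * R) : (0 <= (riesz_kernel q z.1 z.2)%:E)%E by rewrite lee_fin riesz_kernel_ge0.
pose E1 k : set (R * R) := cell N k `*` (unit_itv R `\` cell N k).
pose E2 k : set (R * R) := (unit_itv R `\` cell N k) `*` cell N k.
pose K := fun z : R * R => riesz_kernel q z.1 z.2.
have mc k : measurable (cell N k : set R) by exact: measurable_cell.
have mDc k : measurable (unit_itv R `\` cell N k).
  by apply: measurableD; [exact: mD|exact: mc].
have mE1 k : measurable (E1 k) by exact: measurableX.
have mE2 k : measurable (E2 k) by exact: measurableX.
pose M := 2 * (mesh_size R N `^ (1 - q) / (q * (1 - q))).
have cellM k : (k < N)%N ->
    (\int[mu]_(x in cell N k) \int[mu]_(y in unit_itv R `\` cell N k) (riesz_kernel q x y)%:E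
     <= M%:E)%E.
  move=> kN; rewrite /M -(mesh_pointB N k); apply: integral_riesz_kernel_cell => //.
  - exact: mesh_point_ge0.
  - exact: mesh_point_ltS.
  - exact: mesh_point_le1.
have E1M k : (k < N)%N -> (\int[(mu \x mu)%E]_(z in E1 k) (K z)%:E <= M%:E)%E.
  by move=> kN; rewrite (tonelli_rectangle1 mk k0 (mc k) (mDc k)); exact: cellM.
(* the kernel is symmetric, so swapping the integrals reduces this to E1 *)
have E2M k : (k < N)%N -> (\int[(mu \x mu)%E]_(z in E2 k) (K z)%:E <= M%:E)%E.
  move=> kN; rewrite (tonelli_rectangle2 mk k0 (mDc k) (mc k)).
  under eq_integral do under eq_integral do rewrite riesz_kernelC.
  exact: cellM.
have mKE E : measurable E -> measurable_fun setT (fun z => ((K \_ E) z)%:E).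
  move=> mE; apply/measurable_EFinP; apply/(measurable_restrictT _ _).1 => //.
  by apply: measurable_funTS; exact: measurable_riesz_kernel.
have KE0 (E : set (R * R)) z : (0 <= ((K \_ E) z)%:E)%E.
  by rewrite lee_fin patchE; case: ifP => // _; exact: riesz_kernel_ge0.
have intKE E : measurable E ->
    (\int[(mu \x mu)%E]_z ((K \_ E) z)%:E = \int[(mu \x mu)%E]_(z in E) (K z)%:E)%E.
  move=> mE; rewrite [RHS]integral_mkcond; apply: eq_integral => z _.
  by rewrite !patchE; case: ifP.
rewrite /gagliardo -(tonelli_rectangle1 mF F0 mD mD) integral_mkcond.
pose c k := 2 `^ p * `|a k| `^ p.
have c0 k : 0 <= c k by rewrite mulr_ge0 ?powR_ge0.
have term0 k (z : R * R) :
    (0 <= (c k)%:E * (((K \_ (E1 k)) z)%:E + ((K \_ (E2 k)) z)%:E))%E.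
  by apply: mule_ge0; [rewrite lee_fin|apply: adde_ge0].
apply: (@le_trans _ _ (\int[(mu \x mu)%E]_z
   (\sum_(k < N) ((c k)%:E * (((K \_ (E1 k)) z)%:E + ((K \_ (E2 k)) z)%:E)))%E)%E).
  have sum0 (z : R * R) : (0 <= \sum_(k < N) ((c k)%:E * (((K \_ (E1 k)) z)%:E + ((K \_ (E2 k)) z)%:E)))%E.
    by apply: sume_ge0 => k _; exact: term0.
  apply: ge0_le_integral => //.
  - by move=> z _; apply: erestrict_ge0 => ? _.
  - apply/(measurable_restrictT _ _).1; first exact: measurableX.
    exact: measurable_funTS.
  - apply: emeasurable_sum => k; apply: emeasurable_funM; first exact: measurable_cst.
    by apply: emeasurable_funD; exact: mKE.
  - move=> [x y] _; rewrite patchE; case: ifPn => // /set_mem[/= xD yD].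
    under eq_bigr do rewrite -EFinD -EFinM.
    rewrite sumEFin lee_fin; exact: gagliardo_step_pointwise.
rewrite ge0_integral_sum//; last first.
- by move=> k; apply: emeasurable_funM; [exact: measurable_cst|
    by apply: emeasurable_funD; exact: mKE].
apply: (@le_trans _ _ (\sum_(k < N) ((c k)%:E * (M%:E + M%:E)))%E).
  apply: lee_sum => k _; rewrite ge0_integralZl//; last 3 first.
  - by apply: emeasurable_funD; exact: mKE.
  - by move=> z _; rewrite adde_ge0.
  - by rewrite lee_fin.
  apply: lee_wpmul2l; first by rewrite lee_fin.
  rewrite ge0_integralD//; [|exact: mKE|exact: mKE].
  by rewrite !intKE//; apply: leeD; [exact: E1M|exact: E2M].
under eq_bigr do rewrite -EFinD -EFinM.
rewrite sumEFin lee_fin -mulr_suml -mulr_sumr /M.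
rewrite le_eqVlt; apply/orP; left; apply/eqP; field.
by rewrite !gt_eqF ?subr_gt0.
Qed.

End Gagliardo.

(** * Lebesgue norms *)

Section LpNorms.
Context {R : realType}.
Notation mu := (@lebesgue_measure R).
Implicit Types (p : R) (g v : R -> R) (a : nat -> R) (N k : nat).

Let mD := @unit_itv_measurable R.

Lemma lebesgue_measure_unit_itv : mu (unit_itv R) = 1%E.
Proof. by rewrite lebesgue_measure_itv/= lte_fin ltr01 sube0. Qed.

Lemma lebesgue_measure_cell N k : (0 < N)%N ->
  mu (cell N k) = (mesh_size R N)%:E.
Proof.
by move=> N0; rewrite lebesgue_measure_itv/= lte_fin mesh_point_ltS// -EFinB mesh_pointB.
Qed.

Lemma measurable_norm_powR p (A : set R) g : measurable_fun A g ->
  measurable_fun A (fun x => (`|g x| `^ p)%:E).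
Proof.
move=> mg; apply/measurable_EFinP.
exact: (measurableT_comp (measurable_powR _) (measurableT_comp (@normr_measurable _ _) mg)).
Qed.

Lemma Lp_norm_powR p g : 0 < p ->
  (Lp_norm p g `^ p = \int[mu]_(x in unit_itv R) (`|g x| `^ p)%:E)%E.
Proof.
move=> p0; rewrite /Lp_norm unlock -poweRrM mulVf ?gt_eqF// poweRe1; last first.
  by apply: integral_ge0 => x _; exact: poweR_ge0.
rewrite [RHS]integral_mkcond; apply: eq_integral => x _.
rewrite /= !patchE; case: ifP => _//=.
by rewrite normr0 powR0 ?gt_eqF.
Qed.

(** [(0,1)] has finite measure. *)
Lemma bounded_in_Lp p g : 0 < p -> measurable_fun (unit_itv R) g ->
  [bounded g x | x in unit_itv R] -> in_Lp p g.
Proof.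
move=> p0 mg [M [_ gM]].
have gM1 x : unit_itv R x -> `|g x| <= `|M| + 1.
  by move=> xD; apply: gM => //; rewrite ltr_pwDr// ler_norm.
rewrite /in_Lp; apply/andP; split; rewrite inE/=.
  by apply/(measurable_restrictT _ _).1.
rewrite /finite_norm -[X in (X < _)%E]/(Lp_norm p g).
have -> : Lp_norm p g = ((Lp_norm p g `^ p) `^ p^-1)%E.
  by rewrite -poweRrM mulfV ?gt_eqF// poweRe1// Lnorm_ge0.
apply: poweR_lty; rewrite Lp_norm_powR//.
apply: (@le_lt_trans _ _ (\int[mu]_(x in unit_itv R) ((`|M| + 1) `^ p)%:E)%E).
  apply: ge0_le_integral => //.
  - exact: measurable_norm_powR.
  - move=> x xD; rewrite lee_fin; apply: ge0_ler_powR; rewrite ?nnegrE ?addr_ge0//.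
      exact: ltW.
    exact: gM1.
by rewrite integral_cst//= lebesgue_measure_unit_itv mule1 ltry.
Qed.

Lemma integral_step_powR p N a : (0 < N)%N ->
  (\int[mu]_(x in unit_itv R) (`|step N a x| `^ p)%:E =
   (mesh_size R N * \sum_(k < N) `|a k| `^ p)%:E)%E.
Proof.
move=> N0.
rewrite /unit_itv integral_itv_obnd_cbnd; last first.
  by apply: measurable_norm_powR; apply: measurable_funTS; exact: measurable_step.
have mc k : measurable (cell N k : set R) by exact: measurable_cell.
have m01 : measurable (`[0, 1[%classic : set R) by exact: measurable_itv.
transitivity (\int[mu]_(x in `[0%R, 1%R[)
    (\sum_(k < N) (`|a k| `^ p * \1_(cell N k) x)%:E))%E.
  apply: eq_integral => x /set_mem/=; rewrite in_itv/= => x01.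
  by rewrite step_norm_powR// sumEFin.
rewrite ge0_integral_sum//; last first.
- move=> k; apply/measurable_EFinP; apply: measurable_funM; first exact: measurable_cst.
  by apply: measurable_funTS; apply: measurable_indic; exact: mc.
under eq_bigr => k _.
  under eq_integral do rewrite EFinM.
  rewrite ge0_integralZl//; last first.
    by apply/measurable_EFinP; apply: measurable_funTS; apply: measurable_indic; exact: mc.
  rewrite integral_indic//; last exact: mc.
  rewrite (_ : cell N k `&` `[0, 1[ = cell N k); last first.
    apply/setIidl => x; rewrite /cell/= !in_itv/= => /andP[kx xk].
    by rewrite (le_trans (mesh_point_ge0 _ _) kx) (lt_le_trans xk)// mesh_point_le1.
  rewrite /= lebesgue_measure_cell// -EFinM.
  over.
by rewrite /= sumEFin -mulr_suml mulrC.
Qed.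

End LpNorms.

(** * The inverse estimate *)

Theorem corollary3p4 (R : realType) (s p : R)
    (s_gt0 : 0 < s) (s_lt1 : s < 1) (p_ge1 : 1 <= p) (sp_lt1 : s * p < 1) :
  exists2 C : R, 0 < C &
    forall N : nat, (0 < N)%N -> forall v : R -> R, X_h N v ->
      (W1sp_seminorm s p v <= (C * mesh_size R N `^ (- s))%:E * W1p_norm p v)%E
      /\ in_W1sp s p v.
Proof.
have p0 : 0 < p by lra.
have pN0 : p != 0 by rewrite gt_eqF.
have pV0 : 0 < p^-1 by rewrite invr_gt0.
pose q := s * p.
have q0 : 0 < q by rewrite mulr_gt0.
have q1 : 0 < 1 - q by rewrite subr_gt0.
pose C1 := 2 `^ p * 4 / (q * (1 - q)).
have C10 : 0 < C1.
  by rewrite /C1 divr_gt0 ?mulr_gt0// powR_gt0.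
exists (C1 `^ p^-1); first exact: powR_gt0.
move=> N N0 v vX; have [cv _ _ _] := vX.
have [a [b vab]] := X_h_slopes N0 vX.
have wstep := step_weak_derivative N0 cv vab.
(* the chosen representative is a weak derivative because one exists *)
have wg : is_weak_derivative v (weak_derivative v) by exact: (xgetPex _ (ex_intro _ _ wstep)).
have ae_g := weak_derivative_ae_unique wg wstep.
set g := weak_derivative v in wg ae_g *.
have mD := @unit_itv_measurable R.
have mg : measurable_fun (unit_itv R) g by case: wg => _ [].
have mstep : measurable_fun (unit_itv R) (step N a).
  by apply: measurable_funTS; exact: measurable_step.
set h := mesh_size R N; have h0 : 0 < h by exact: mesh_size_gt0.
pose A := h * \sum_(k < N) `|a k| `^ p.
have A0 : 0 <= A.
  by apply: mulr_ge0; [exact: ltW|apply: sumr_ge0 => k _; exact: powR_ge0].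
have normg : (Lp_norm p g `^ p = A%:E)%E.
  rewrite Lp_norm_powR// -integral_step_powR//; apply: ge0_ae_eq_integral => //.
  - exact: measurable_norm_powR.
  - exact: measurable_norm_powR.
  - by apply: filterS ae_g => x + xD => /(_ xD) ->.
have gagl : (gagliardo p q g <= (C1 * h `^ (- q) * A)%:E)%E.
  rewrite (gagliardo_ae_eq _ _ mg mstep ae_g).
  apply: le_trans (gagliardo_step_le _ p0 q0 _ N0) _; first by rewrite -subr_gt0.
  have hE : h `^ (1 - q) = h `^ (- q) * h.
    rewrite addrC powRD; last by rewrite (gt_eqF h0) implybT.
    by rewrite powRr1// ltW.
  by rewrite lee_fin -/h -/C1 /A hE !mulrA.
have gagl0 : (0 <= gagliardo p q g)%E.
  by apply: integral_ge0 => x _; apply: integral_ge0 => y _; exact: gagliardo_integrand_ge0.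
split.
  rewrite W1sp_seminormE -/q -/g.
  apply: (@le_trans _ _ ((C1 * h `^ (- q) * A)%:E `^ p^-1)%E).
    apply: (gt0_ler_poweR (ltW pV0)); rewrite ?in_itv/= ?leey ?andbT//.
    exact: le_trans gagl.
  have Ch0 : 0 <= C1 * h `^ (- q) by apply: mulr_ge0; [exact: ltW|exact: powR_ge0].
  rewrite poweR_EFin (powRM _ Ch0 A0) (powRM _ (ltW C10) (powR_ge0 _ _)).
  rewrite -powRrM mulNr mulfK// EFinM.
  apply: lee_wpmul2l; first by rewrite lee_fin mulr_ge0 ?powR_ge0//.
  rewrite -poweR_EFin -normg.
  apply: (gt0_ler_poweR (ltW pV0)).
  - by rewrite in_itv/= leey poweR_ge0.
  - by rewrite in_itv/= leey adde_ge0 ?poweR_ge0.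
  - by rewrite leeDr ?poweR_ge0.
split.
  split.
    apply: bounded_in_Lp => //; first by case: wg => -[].
    have /compact_bounded[M [Mr MP]] : compact (v @` `[0, 1]).
      by apply: continuous_compact => //; exact: segment_compact.
    exists M; split => // t Mt x xD; apply: MP => //.
    by exists x => //; exact: unit_itv_sub01.
  exists (step N a) => //; apply: bounded_in_Lp => //; exact: step_bounded.
rewrite W1sp_seminormE; apply: poweR_lty; apply: le_lt_trans gagl _.
exact: ltry.
Qed.
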